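(* For every $n\in\mathbb{Z}^+$ and every set $S$ of positive integers, there is a bijection between $\mathrm{FR}^{\mathrm{T2}}_{n,S}$ and $\mathrm{UPF}^{\mathrm{T2}}_{n,S}$.
   Context: A Fubini ranking of length $n$ is a tuple $(b_1,\dots,b_n)\in[n]^n$ that satisfies two conditions. First, some $b_i$ equals $1$. Second, for every value $x$ occurring exactly $k>0$ times, the next larger value occurring in the tuple (if there is one) is $x+k$. $\mathrm{FR}^{\mathrm{T2}}_{n,S}$ is the set of Fubini rankings of length $n$ in which every value that occurs has its number of occurrences in $S$. A parking preference $(a_1,\dots,a_n)\in[n]^n$ describes $n$ cars entering a one-way street with spots $1,\dots,n$ in the order $1,\dots,n$; car $i$ parks in the first unoccupied spot numbered $\ge a_i$. It is a parking function if all cars park. It is a unit interval parking function if it is a parking function and every car $i$ parks in spot $a_i$ or spot $a_i+1$. Block structure: let $\alpha^{\uparrow}=(a_1',\dots,a_n')$ be the weakly increasing rearrangement of $\alpha$. The indices $i$ with $a'_i=i$ are block starts; the block structure $\pi_1|\cdots|\pi_k$ cuts $\alpha^{\uparrow}$ into consecutive segments, each beginning at a block start. $\mathrm{UPF}^{\mathrm{T2}}_{n,S}$ is the set of unit interval parking functions of length $n$ all of whose blocks have size in $S$. *)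

(* Defs.v *)
From mathcomp Require Import all_boot.
From mathcomp Require Import boolp classical_sets functions.

Set Implicit Arguments.
Unset Strict Implicit.
Unset Printing Implicit Defensive.

Local Open Scope nat_scope.
Local Open Scope classical_set_scope.

(* Values, spots and block starts are numbered from 1, as on paper; [nth],    *)
(* [take] and [drop] count from 0, hence the shifts by one below.             *)

Definition in_cube (n : nat) (a : n.-tuple nat) : Prop :=
  forall i : 'I_n, 1 <= tnth a i <= n.

Definition next_value (s : seq nat) (x y : nat) : Prop :=
  [/\ y \in s, x < y & forall z, z \in s -> x < z -> y <= z].

Definition fubini_ranking (n : nat) (b : n.-tuple nat) : Prop :=
  [/\ in_cube b,
      1 \in b
    & forall x y, x \in b -> next_value b x y -> y = x + count_mem x b].

Definition FR_T2 (n : nat) (S : set nat) : set (n.-tuple nat) :=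
  [set b | fubini_ranking b /\ forall x, x \in b -> S (count_mem x b)].

(* [None] when every spot of {a, ..., n} is occupied. *)
Definition first_free (n : nat) (occ : seq nat) (a : nat) : option nat :=
  ohead [seq s <- iota a (n.+1 - a) | s \notin occ].

(* The entry of index i is the spot in which car i.+1 parks, or [None] if that *)
(* car leaves the street without parking.                                     *)
Fixpoint park_from (n : nat) (occ a : seq nat) : seq (option nat) :=
  if a is x :: a' then
    let s := first_free n occ x in
    s :: park_from n (if s is Some p then p :: occ else occ) a'
  else [::].

Definition outcome (n : nat) (a : n.-tuple nat) : seq (option nat) :=
  park_from n [::] a.

Definition parking_function (n : nat) (a : n.-tuple nat) : Prop :=
  in_cube a /\ forall i : 'I_n, nth None (outcome a) i <> None.

Definition unit_interval_parking_function (n : nat) (a : n.-tuple nat) : Prop :=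
  parking_function a /\
  forall i : 'I_n, nth None (outcome a) i = Some (tnth a i) \/
                   nth None (outcome a) i = Some (tnth a i).+1.

Definition rearr (n : nat) (a : n.-tuple nat) : seq nat := sort leq a.

Definition block_starts (n : nat) (a : n.-tuple nat) : seq nat :=
  [seq i <- iota 1 n | nth 0 (rearr a) i.-1 == i].

(* The position n.+1, just past the end, closes the last block. *)
Definition block_end (n : nat) (a : n.-tuple nat) (i : nat) : nat :=
  head n.+1 [seq j <- block_starts a | i < j].

Definition block_structure (n : nat) (a : n.-tuple nat) : seq (seq nat) :=
  [seq take (block_end a i - i) (drop i.-1 (rearr a)) | i <- block_starts a].

Definition UPF_T2 (n : nat) (S : set nat) : set (n.-tuple nat) :=
  [set a | unit_interval_parking_function a /\
           forall p, p \in block_structure a -> S (size p)].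

Arguments FR_T2 : clear implicits.
Arguments UPF_T2 : clear implicits.

(* Main.v *)
(** Say that [b] is ranked when every value [x] of [b] is one more than the
    number of entries below [x]; this is the Fubini condition, and it makes the
    intervals [x, x + k) (x a value, k its multiplicity) disjoint.  The
    bijection replaces the occurrences of [x], read from left to right, by
    x, x, x+1, ..., x+k-2; the corresponding cars park in x, x+1, ..., x+k-1.
    A car is lucky when it parks in its preferred spot.  If [p] lists the spots
    taken by a unit interval parking function, its increasing rearrangement is
    [s - (s is not lucky)] for s = 1, ..., n, so block starts are lucky spots.
    Within a block the spots fill from left to right, so sending each car to the
    last lucky spot at or before its own inverts the map. *)

Require Import Defs.
From mathcomp Require Import all_boot.
From mathcomp Require Import boolp classical_sets functions.
From mathcomp Require Import zify.

Set Implicit Arguments.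
Unset Strict Implicit.
Unset Printing Implicit Defensive.

Local Open Scope nat_scope.
Local Open Scope classical_set_scope.

(** * Ranked sequences *)

Definition ranked (b : seq nat) : Prop :=
  forall x, x \in b -> x = (count (ltn^~ x) b).+1.

Lemma count_leq_split (b : seq nat) x :
  count (leq^~ x) b = count (ltn^~ x) b + count_mem x b.
Proof.
by elim: b => //= y b ->; case: (ltngtP y x) => h; lia.
Qed.

(** The [x - 1] entries below [x] and all copies of [x] are among the [y - 1] entries below [y]. *)
Lemma ranked_interval b x y :
  ranked b -> x \in b -> y \in b -> x < y -> x + count_mem x b <= y.
Proof.
move=> rb xb yb ltxy; rewrite {1}(rb x xb) [leqRHS](rb y yb) addSn ltnS.
rewrite -count_leq_split; apply: sub_count => z /= h.
exact: leq_ltn_trans h ltxy.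
Qed.

Lemma ranked_bound b x : ranked b -> x \in b -> x + count_mem x b <= (size b).+1.
Proof.
by move=> rb xb; rewrite {1}(rb x xb) addSn ltnS -count_leq_split count_size.
Qed.

Lemma ranked_next b x y :
  ranked b -> x \in b -> next_value b x y -> y = x + count_mem x b.
Proof.
move=> rb xb [yb ltxy ymin]; rewrite {1}(rb y yb) {1}(rb x xb) addSn.
rewrite -count_leq_split; congr _.+1; apply: eq_in_count => z zb /=.
by case: (leqP z x) => h; [lia | have := ymin z zb h; lia].
Qed.

(** Strong induction on the value: the Fubini step leads from the largest value [y] below [x] to
    [x], and no entry lies strictly between them. *)
Lemma fubini_ranked n (b : n.-tuple nat) : fubini_ranking b -> ranked b.
Proof.
case=> cube b1 step.
have bpos z : z \in b -> 0 < z.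
  by case/tnthP=> i ->; case/andP: (cube i).
elim/ltn_ind => x IH xb.
have [x1|x1] := leqP x 1.
  have -> : x = 1 by have := bpos _ xb; lia.
  rewrite (_ : count _ b = 0) //; apply/eqP; rewrite -leqn0 leqNgt -has_count.
  by apply/hasPn => z zb /=; have := bpos z zb; lia.
have ex : exists y, (y \in b) && (y < x) by exists 1; rewrite b1.
have bd y : (y \in b) && (y < x) -> y <= x by case/andP=> _ /ltnW.
case: (ex_maxnP ex bd) => y /andP[yb ltyx] ymax.
have nxt : next_value b y x.
  split=> // z zb ltyz; rewrite leqNgt; apply/negP => ltzx.
  by have := ymax z; rewrite zb ltzx => /(_ isT); lia.
rewrite {1}(step y x yb nxt) {1}(IH y ltyx yb) addSn -count_leq_split.
congr _.+1; apply: eq_in_count => z zb /=.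
have := ymax z; rewrite zb /=; lia.
Qed.

Lemma ranked_fubini n (b : n.-tuple nat) : 0 < n -> ranked b -> fubini_ranking b.
Proof.
move=> n0 rb; split.
- move=> i; have ib : tnth b i \in b by exact: mem_tnth.
  have := ranked_bound rb ib; rewrite size_tuple.
  have : 0 < count_mem (tnth b i) b by rewrite -has_count has_pred1.
  have := rb _ ib; lia.
- have ex : exists y, y \in tval b.
    by exists (tnth b (Ordinal n0)); exact: mem_tnth.
  case: (ex_minnP ex) => y yb ymin.
  suff <- : y = 1 by [].
  rewrite (rb y yb) (_ : count _ b = 0) //.
  apply/eqP; rewrite -leqn0 leqNgt -has_count; apply/hasPn => z zb /=.
  by have := ymin z zb; lia.
- by move=> x y xb; apply: ranked_next.
Qed.

(** * Unit interval parking *)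

Lemma first_freeP n occ a p :
  first_free n occ a = Some p <->
  [/\ a <= p <= n, p \notin occ & forall q, a <= q < p -> q \in occ].
Proof.
rewrite /first_free.
(* Describing the range by its length lets the induction run on [m]; truncated subtraction makes it
   empty when [a > n]. *)
have -> : (a <= p <= n) = (a <= p < a + (n.+1 - a)) by lia.
move: (n.+1 - a) => m; elim: m a => [|m IH] a /=.
  by split=> // -[]; lia.
case: ifP => /= aocc.
  split=> [[<-]|[ap pocc qocc]]; first by split=> // [|q]; lia.
  have [<- //|nap] := eqVneq a p.
  by have := qocc a; rewrite (negbTE aocc) => /(_ ltac:(lia)).
rewrite IH; split=> -[ap pocc qocc].
- split=> //; first by lia.
  move=> q qp; have [->|naq] := eqVneq q a; first by case: (a \in occ) aocc.
  by apply: qocc; lia.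
- have nap : a != p by apply: contraFneq aocc => ->.
  split=> //; first by lia.
  by move=> q qp; apply: qocc; lia.
Qed.

Lemma eq_first_free n occ occ' a :
  occ =i occ' -> first_free n occ a = first_free n occ' a.
Proof. by move=> e; rewrite /first_free; under eq_filter do rewrite e. Qed.

Lemma park_from_SomeP n (a p occ : seq nat) : size p = size a ->
  park_from n occ a = map Some p <->
  forall i, i < size a ->
    first_free n (take i p ++ occ) (nth 0 a i) = Some (nth 0 p i).
Proof.
elim: a p occ => [|x a IH] [|y p] occ //= [sz].
(* The simulation prepends each new spot to [occ], whereas [take i p] keeps the order of arrival;
   [first_free] sees only membership. *)
have swap i : take i p ++ y :: occ =i (y :: take i p) ++ occ.
  by move=> z; rewrite !(mem_cat, inE) orbCA orbA.
split.
- case=> fy; rewrite fy => /(IH _ _ sz) h [|i] //= ilt.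
  by rewrite -(h i ilt); apply: eq_first_free => z; rewrite swap.
- move=> h; have /= fy := h 0 isT; rewrite fy; congr cons.
  apply/(IH _ _ sz) => i ilt; rewrite -(h i.+1 ilt).
  exact: eq_first_free.
Qed.

Lemma size_park_from n occ a : size (park_from n occ a) = size a.
Proof. by elim: a occ => //= x a IH occ; rewrite IH. Qed.

(* [p] lists the spots taken by the cars with preferences [a]. *)
Definition unit_parks (n : nat) (a p : seq nat) : Prop :=
  size p = size a /\
  forall i, i < size a ->
    [/\ 0 < nth 0 a i, nth 0 p i <= n, nth 0 p i \notin take i p &
        nth 0 p i = nth 0 a i \/
        nth 0 p i = (nth 0 a i).+1 /\ nth 0 a i \in take i p].

(** A car parking one past its preference skips only the preferred spot, so the occupancy of that
    single spot captures the first-free condition. *)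
Lemma unit_intervalP n (a : n.-tuple nat) :
  unit_interval_parking_function a <-> exists p, unit_parks n a p.
Proof.
split.
- case=> -[cube parks] unit.
  (* Every car parks, so the default [0] is never reached. *)
  pose p := map (odflt 0) (outcome a).
  have szo : size (outcome a) = n by rewrite size_park_from size_tuple.
  have szp : size p = size a by rewrite size_map szo size_tuple.
  have op : outcome a = map Some p.
    apply: (@eq_from_nth _ None); first by rewrite !size_map.
    move=> i; rewrite szo => ilt; rewrite -map_comp (nth_map None) ?szo //=.
    by have := parks (Ordinal ilt); case: (nth None (outcome a) i).
  exists p; split=> // i; rewrite size_tuple => ilt.
  have := (park_from_SomeP n [::] szp).1 op i.
  rewrite size_tuple cats0 => /(_ ilt)/first_freeP[/andP[ap pn] pocc qocc].
  have [a0 _] := andP (cube (Ordinal ilt)).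
  have := unit (Ordinal ilt); rewrite op (nth_map 0) ?szp ?size_tuple //=.
  rewrite !(tnth_nth 0) /= in a0 *.
  move=> [[e]|[e]]; split=> //; first by left.
  by right; split=> //; apply: qocc; rewrite e; lia.
- case=> p [szp h].
  have op : outcome a = map Some p.
    apply/park_from_SomeP => // i ilt; rewrite cats0; apply/first_freeP.
    have [a0 pn pocc up] := h i ilt; split=> //.
    + by case: up => [e|[e _]]; lia.
    + case: up => [e q|[e aocc] q qp]; first by lia.
      by have -> : q = nth 0 a i by lia.
  have nthp (i : 'I_n) : nth None (outcome a) i = Some (nth 0 p i).
    by rewrite op (nth_map 0) // szp size_tuple.
  split; first split.
  + move=> i; rewrite (tnth_nth 0).
    have [] := h i; rewrite ?size_tuple // => a0 pn _ up.
    by case: up => [e|[e _]]; lia.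
  + by move=> i; rewrite nthp.
  + move=> i; rewrite nthp (tnth_nth 0).
    have [] := h i; rewrite ?size_tuple // => _ _ _ up.
    by case: up => [->|[-> _]]; [left|right].
Qed.

Lemma uniq_nth_take (p : seq nat) :
  (forall i, i < size p -> nth 0 p i \notin take i p) -> uniq p.
Proof.
move=> h; apply/(uniqP 0) => i j; rewrite !inE => ilt jlt e.
have aux k l : k < l -> l < size p -> nth 0 p k <> nth 0 p l.
  move=> kl lp e'; have := h l lp; rewrite -e' -(nth_take 0 kl) mem_nth //.
  by rewrite size_take lp.
by case: (ltngtP i j) => // ij; [case: (aux i j) | case: (aux j i)].
Qed.

(** Each spot is fresh when taken, and [n] distinct elements of [1, ..., n] exhaust that range. *)
Lemma unit_parks_perm n a p :
  size a = n -> unit_parks n a p -> perm_eq p (iota 1 n).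
Proof.
move=> sza [szp h].
have up : uniq p by apply: uniq_nth_take => i; rewrite szp => /h[].
have sub : {subset p <= iota 1 n}.
  move=> x xp; rewrite mem_iota.
  have /h : index x p < size a by rewrite -szp index_mem.
  by rewrite nth_index //; case=> a0 xn _ [e|[e _]]; lia.
apply: uniq_perm; rewrite ?iota_uniq //.
by have [] := uniq_min_size up sub; rewrite ?size_iota ?szp ?sza.
Qed.

(** Lowering strictly increasing numbers by at most one keeps them weakly increasing, so
    [map h (iota 1 n)] is already the sorted rearrangement. *)
Lemma block_starts_lucky n (a : n.-tuple nat) (p : seq nat) (L : pred nat) :
  perm_eq p (iota 1 n) -> a = [seq s - ~~ L s | s <- p] :> seq nat ->
  block_starts a = [seq s <- iota 1 n | L s].
Proof.
move=> pp ea; pose h s := s - ~~ L s.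
have -> : block_starts a = [seq i <- iota 1 n | nth 0 (map h (iota 1 n)) i.-1 == i].
  suff e : rearr a = map h (iota 1 n) by rewrite /block_starts e.
  transitivity (sort leq (map h (iota 1 n))).
    by rewrite /rearr ea; apply/perm_sortP/(perm_map h pp);
      [exact: leq_total | exact: leq_trans | exact: anti_leq].
  apply: sorted_sort; first exact: leq_trans.
  apply: (homo_sorted (e := ltn)) (iota_ltn_sorted 1 n) => s t /= st.
  by rewrite /h; case: (L s); case: (L t) => /=; lia.
apply: eq_in_filter => i; rewrite mem_iota => ilt.
rewrite (nth_map 0) ?size_iota; last by lia.
rewrite nth_iota; last by lia.
rewrite (_ : 1 + i.-1 = i); last by lia.
(* Here [i] is positive, so the truncated [i - 1] differs from [i]. *)
by rewrite /h; case: (L i) => /=; lia.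
Qed.

(** * From rankings to parking functions *)

Definition spots (b : seq nat) : seq nat :=
  mkseq (fun i => nth 0 b i + count_mem (nth 0 b i) (take i b)) (size b).

(** The predecessor truncates at [0], so the first two occurrences of a value both keep it. *)
Definition spread (b : seq nat) : seq nat :=
  mkseq (fun i => nth 0 b i + (count_mem (nth 0 b i) (take i b)).-1) (size b).

Lemma size_spread b : size (spread b) = size b.
Proof. by rewrite size_mkseq. Qed.

Lemma count_mem_take_lt (b : seq nat) i j :
  i < j -> i < size b ->
  count_mem (nth 0 b i) (take i b) < count_mem (nth 0 b i) (take j b).
Proof.
move=> ij ib.
have -> : take j b = take i.+1 b ++ drop i.+1 (take j b).
  by rewrite -(take_takel b ij) cat_take_drop.
by rewrite count_cat (take_nth 0 ib) -cats1 count_cat /= eqxx; lia.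
Qed.

Lemma count_mem_take_nth (b : seq nat) i :
  i < size b -> count_mem (nth 0 b i) (take i b) < count_mem (nth 0 b i) b.
Proof. by move=> ib; have := count_mem_take_lt ib ib; rewrite take_size. Qed.

(** Used to exhibit the earlier car that sits in the preferred spot of an unlucky one. *)
Lemma nth_occurrence (b : seq nat) x c : c < count_mem x b ->
  exists i, [/\ i < size b, nth 0 b i = x & count_mem x (take i b) = c].
Proof.
elim: b c => [|y b IH] c //=; case: (eqVneq y x) => [->|nyx] /=.
  case: c => [|c] hc; first by exists 0.
  have [i [ib bi ci]] := IH c hc.
  by exists i.+1; rewrite /= eqxx ci.
move=> hc; have [i [ib bi ci]] := IH c hc.
by exists i.+1; rewrite /= (negbTE nyx) ci.
Qed.

(** Distinct values own disjoint intervals, and copies of one value differ in their occurrence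
    number. *)
Lemma ranked_nth_occurrence_inj b i j : ranked b -> i < size b -> j < size b ->
  nth 0 b i + count_mem (nth 0 b i) (take i b) =
  nth 0 b j + count_mem (nth 0 b j) (take j b) -> i = j.
Proof.
move=> rb ib jb e.
have := count_mem_take_nth ib; have := count_mem_take_nth jb.
have bi : nth 0 b i \in b by exact: mem_nth.
have bj : nth 0 b j \in b by exact: mem_nth.
case: (ltngtP (nth 0 b i) (nth 0 b j)) => [lt|lt|eqb] hj hi.
- by have := ranked_interval rb bi bj lt; lia.
- by have := ranked_interval rb bj bi lt; lia.
case: (ltngtP i j) => // ij.
- by have := count_mem_take_lt ij ib; rewrite eqb in e *; lia.
- by have := count_mem_take_lt ij jb; rewrite eqb in e *; lia.
Qed.

Lemma unit_parks_spread b :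
  ranked b -> unit_parks (size b) (spread b) (spots b).
Proof.
move=> rb; split; first by rewrite !size_mkseq.
move=> i; rewrite size_spread => ib; rewrite !nth_mkseq //.
have bi : nth 0 b i \in b by exact: mem_nth.
have hi := count_mem_take_nth ib.
have earlier j : j < i -> nth 0 (spots b) j \in take i (spots b).
  move=> ji; rewrite -(nth_take 0 ji) mem_nth // size_take size_mkseq ib //.
split.
- by have := rb _ bi; lia.
- by have := ranked_bound rb bi; lia.
- apply/negP => /(nthP 0)[j]; rewrite size_take size_mkseq ib => ji.
  rewrite nth_take // nth_mkseq ?(ltn_trans ji) // => e.
  by have := ranked_nth_occurrence_inj rb (ltn_trans ji ib) ib e; lia.
- case E: (count_mem _ _) => [|c]; [by left | right; split; first by rewrite addnS].
  (* The preferred spot [nth 0 b i + c] was taken by the previous copy of the same value, the one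
     preceded by exactly [c] copies. *)
  have [j []] : exists j, [/\ j < size (take i b), nth 0 (take i b) j = nth 0 b i
                & count_mem (nth 0 b i) (take j (take i b)) = c].
    by apply: nth_occurrence; rewrite E.
  rewrite size_take ib => ji; rewrite nth_take // take_takel ?(ltnW ji) // => e ec.
  have := earlier j ji; rewrite nth_mkseq ?(ltn_trans ji ib) //.
  by rewrite e ec.
Qed.

Lemma spread_lucky b : ranked b -> spread b = [seq s - (s \notin b) | s <- spots b].
Proof.
move=> rb; apply: (@eq_from_nth _ 0); first by rewrite size_map !size_mkseq.
move=> i; rewrite size_spread => ib.
rewrite (nth_map 0) ?size_mkseq // !nth_mkseq //.
have bi : nth 0 b i \in b by exact: mem_nth.
have hi := count_mem_take_nth ib.
case E: (count_mem _ _) => [|c] in hi *; first by rewrite addn0 bi subn0.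
(* A spot strictly inside the interval of a value cannot itself be a value. *)
suff -> : nth 0 b i + c.+1 \notin b by rewrite /=; lia.
apply/negP => yb.
have := ranked_interval rb bi yb ltac:(lia); lia.
Qed.

(** * Blocks of the image, and injectivity *)

Fact spread_tuple_subproof n (b : n.-tuple nat) : size (spread b) == n.
Proof. by rewrite size_spread size_tuple. Qed.

Definition spread_tuple n (b : n.-tuple nat) : n.-tuple nat :=
  Tuple (spread_tuple_subproof b).

Lemma block_starts_spread n (b : n.-tuple nat) : ranked b ->
  block_starts (spread_tuple b) = [seq s <- iota 1 n | s \in b].
Proof.
move=> rb; have := unit_parks_spread rb; rewrite size_tuple => up.
apply: (block_starts_lucky (p := spots b) (L := mem b)); last exact: spread_lucky.
by apply: unit_parks_perm up; rewrite size_spread size_tuple.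
Qed.

Lemma mem_block_starts_spread n (b : n.-tuple nat) : ranked b ->
  block_starts (spread_tuple b) =i b.
Proof.
move=> rb x; rewrite block_starts_spread // mem_filter mem_iota.
case xb: (x \in b) => //=.
have := ranked_bound rb xb; rewrite size_tuple.
have : 0 < count_mem x b by rewrite -has_count has_pred1.
have := rb x xb; lia.
Qed.

Lemma block_end_spread n (b : n.-tuple nat) x : ranked b -> x \in b ->
  block_end (spread_tuple b) x = x + count_mem x b.
Proof.
move=> rb xb; rewrite /block_end.
have mem z : z \in [seq j <- block_starts (spread_tuple b) | x < j]
             = (x < z) && (z \in b).
  by rewrite mem_filter mem_block_starts_spread.
have : sorted ltn [seq j <- block_starts (spread_tuple b) | x < j].
  rewrite block_starts_spread //.
  by do 2![apply: (sorted_filter ltn_trans)]; exact: iota_ltn_sorted.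
case: [seq _ <- _ | _] mem => [|y s] /= mem srt.
  (* No later block start: all [n] entries are at most [x], which matches the default [n.+1] of
     [block_end]. *)
  rewrite {1}(rb x xb) addSn -count_leq_split -{1}(size_tuple b).
  congr _.+1; apply/esym/eqP; rewrite -all_count; apply/allP => z zb /=.
  by have := mem z; rewrite zb in_nil; lia.
have /andP[ltxy yb] : (x < y) && (y \in b) by rewrite -mem mem_head.
apply: ranked_next => //; split=> // z zb ltxz.
have := mem z; rewrite zb ltxz inE => /orP[/eqP-> //|zs].
by have /allP/(_ z zs) := order_path_min ltn_trans srt; apply: ltnW.
Qed.

Lemma block_sizes_spread n (b : n.-tuple nat) (S : set nat) : ranked b ->
  (forall p, p \in block_structure (spread_tuple b) -> S (size p)) <->
  (forall x, x \in b -> S (count_mem x b)).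
Proof.
move=> rb.
have sz x : x \in b ->
  size (take (block_end (spread_tuple b) x - x)
             (drop x.-1 (rearr (spread_tuple b)))) = count_mem x b.
  move=> xb; rewrite block_end_spread // addKn size_takel //.
  rewrite size_drop size_sort size_tuple.
  have := ranked_bound rb xb; rewrite size_tuple.
  by have := rb x xb; lia.
split=> [h x xb|h p].
- rewrite -(sz x xb); apply: h; apply/mapP; exists x => //.
  by rewrite mem_block_starts_spread.
- case/mapP=> x; rewrite mem_block_starts_spread // => xb ->.
  by rewrite sz //; apply: h.
Qed.

(** The block starts recover the set of values. If the entries at [i] differed, the larger would lie
    beyond the whole interval of the smaller, while the common preference of car [i] lies inside
    it. *)
Lemma spread_tuple_inj n (b c : n.-tuple nat) :
  ranked b -> ranked c -> spread_tuple b = spread_tuple c -> b = c.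
Proof.
move=> rb rc e; apply: val_inj => /=.
have bc : b =i c.
  by move=> x; rewrite -(mem_block_starts_spread rb) e mem_block_starts_spread.
have half (d d' : n.-tuple nat) i : ranked d -> d =i d' ->
    spread d = spread d' -> i < n -> nth 0 d' i <= nth 0 d i.
  move=> rd dd' /(congr1 (fun s => nth 0 s i)) + ilt.
  rewrite !nth_mkseq ?size_tuple // => ei.
  have id : i < size d by rewrite size_tuple.
  have id' : i < size d' by rewrite size_tuple.
  rewrite leqNgt; apply/negP => lt.
  have d'i : nth 0 d' i \in d by rewrite dd' mem_nth.
  have di : nth 0 d i \in d by exact: mem_nth.
  have := ranked_interval rd di d'i lt.
  by have := count_mem_take_nth id; lia.
have es : spread b = spread c by exact: (congr1 val e).
apply: (@eq_from_nth _ 0) => [|i]; rewrite !size_tuple // => ilt.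
by apply/eqP; rewrite eqn_leq !half // => x; rewrite bc.
Qed.

(** * From parking functions to rankings *)

Fixpoint last_before (L : pred nat) (v : nat) : nat :=
  if L v then v else if v is u.+1 then last_before L u else 0.

Lemma last_before_le (L : pred nat) v : last_before L v <= v.
Proof. by elim: v => [|v IH] /=; case: ifP => // _; exact: leqW. Qed.

Lemma last_before_ge (L : pred nat) v s : L s -> s <= v -> s <= last_before L v.
Proof.
move=> Ls; elim: v => [|v IH] /=; first by case: ifP; lia.
case: ifP => // Lv sv; apply: IH.
by have [e|ns] := eqVneq s v.+1; [rewrite -e Ls in Lv | lia].
Qed.

Lemma last_beforeP (L : pred nat) v s : L s -> s <= v -> L (last_before L v).
Proof.
move=> Ls; elim: v => [|v IH] /=.
  by case: ifP => // L0; rewrite leqn0 => /eqP e; rewrite -e Ls in L0.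
case: ifP => // Lv sv; apply: IH.
by have [e|ns] := eqVneq s v.+1; [rewrite -e Ls in Lv | lia].
Qed.

Lemma last_before_eq (L : pred nat) v w :
  last_before L v <= w <= v -> last_before L w = last_before L v.
Proof.
elim: v => [|v IH] /=; first by case: w => [|w] /andP[].
case: ifP => [Lv wv|Lv /andP[lw]].
  have -> : w = v.+1 by lia.
  by rewrite /= Lv.
rewrite leq_eqVlt => /orP[/eqP->|wv]; first by rewrite /= Lv.
by apply: IH; rewrite lw.
Qed.

Section LuckySpots.

Variables (n : nat) (a p : seq nat).
Hypotheses (sza : size a = n) (parks : unit_parks n a p).

(** Among numbers outside [p], the default of [nth] makes only [0] lucky; this is harmless because
    [1] is lucky as soon as there is a car. *)
Let lucky : pred nat := fun s => nth 0 a (index s p) == s.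
Let start := last_before lucky.

Let szp : size p = n. Proof. by case: parks => ->. Qed.

Let pperm : perm_eq p (iota 1 n). Proof. exact: unit_parks_perm sza parks. Qed.

Let puniq : uniq p. Proof. by rewrite (perm_uniq pperm) iota_uniq. Qed.

Let mem_p x : (x \in p) = (0 < x <= n).
Proof. by rewrite (perm_mem pperm) mem_iota; lia. Qed.

Let lucky_nth i : i < n -> lucky (nth 0 p i) = (nth 0 a i == nth 0 p i).
Proof. by move=> ilt; rewrite /lucky index_uniq ?szp. Qed.

(** An unlucky car in spot [1] would have preference [0]. *)
Let lucky1 : 0 < n -> lucky 1.
Proof.
move=> n0; have p1 : 1 \in p by rewrite mem_p.
have ilt : index 1 p < n by rewrite -szp index_mem.
have [_ /(_ (index 1 p))] := parks; rewrite sza nth_index // => /(_ ilt).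
by rewrite /lucky; case=> a0 _ _ [<-|[e _]] //; lia.
Qed.

Let lucky_start v : v \in p -> lucky (start v).
Proof.
by rewrite mem_p => v0; apply: (@last_beforeP _ _ 1); [apply: lucky1|]; lia.
Qed.

(* An unlucky car finds the spot just before its own already taken. *)
Let block_filled i q :
  i < n -> start (nth 0 p i) <= q <= nth 0 p i -> q \in take i.+1 p.
Proof.
move: {2}(nth 0 p i) (erefl (nth 0 p i)) => v.
elim/ltn_ind: v i => v IH i ev ilt qi.
have ip : i < size p by rewrite szp.
have self : nth 0 p i \in take i.+1 p by rewrite (take_nth 0) // mem_rcons mem_head.
have [-> //|nq] := eqVneq q (nth 0 p i).
have unl : ~~ lucky (nth 0 p i).
  apply/negP => Li; have := @last_before_ge lucky (nth 0 p i) _ Li (leqnn _).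
  by rewrite -/start; lia.
have [_ /(_ i)] := parks; rewrite sza => /(_ ilt)[_ _ _].
case=> [e|[e /(nthP 0)[j]]]; first by move: unl; rewrite lucky_nth // e eqxx.
rewrite size_take ip => ji; rewrite nth_take // => ej.
have {}ej : nth 0 p j = nth 0 a i := ej.
(* Since [q] is below the spot of car [i], so is the start; hence the preceding spot lies in the
   same run. *)
have se : start (nth 0 p j) = start (nth 0 p i).
  by apply: last_before_eq; rewrite -/start; lia.
have /(IH (nth 0 p j)) : nth 0 p j < v by lia.
move=> /(_ j erefl (ltn_trans ji ilt)); rewrite se => /(_ ltac:(lia)) qj.
rewrite -(cat_take_drop j.+1 (take i.+1 p)) take_takel ?mem_cat ?qj //.
exact: ltnW.
Qed.

(** The earlier cars with the same start occupy exactly the spots from that start up to just before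
    the spot of car [i]: [block_filled] gives them all, and applied to an earlier car further right
    it would make the spot of car [i] already taken. *)
Let count_block i : i < n ->
  count_mem (start (nth 0 p i)) (take i (map start p))
  = nth 0 p i - start (nth 0 p i).
Proof.
move=> ilt; have ip : i < size p by rewrite szp.
rewrite -map_take count_map -size_filter.
rewrite -[RHS](size_iota (start (nth 0 p i))); apply: perm_size.
apply: uniq_perm; rewrite ?iota_uniq ?filter_uniq ?take_uniq //.
have [_ /(_ i)] := parks; rewrite sza => /(_ ilt)[_ _ fresh _].
have si := last_before_le lucky (nth 0 p i).
move=> v; rewrite mem_filter mem_iota /= subnKC //.
apply/andP/idP => [[/eqP sv /(nthP 0)[j]]|/andP[sv vp]].
- rewrite size_take ip => ji; rewrite nth_take // => ej.
  have := last_before_le lucky v; rewrite -/start sv => -> /=.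
  rewrite ltnNge; apply/negP => iv.
  have /(block_filled (ltn_trans ji ilt)) :
      start (nth 0 p j) <= nth 0 p i <= nth 0 p j by rewrite ej sv iv andbT.
  move=> pij; case/negP: fresh.
  by rewrite -(cat_take_drop j.+1 (take i p)) take_takel // mem_cat pij.
- split; first by apply/eqP/last_before_eq; rewrite -/start; lia.
  have := block_filled ilt (q := v) ltac:(lia).
  by rewrite (take_nth 0) // mem_rcons inE => /orP[/eqP|//]; lia.
Qed.

(** As [start v] is lucky, [start w] lies below it exactly when [w] does, and [start v - 1] of the
    spots [1, ..., n] do. *)
Lemma unit_parks_ranked : ranked (map start p).
Proof.
move=> _ /mapP[v vp ->]; rewrite count_map.
have Ls := lucky_start vp.
have sv := last_before_le lucky v.
have s0 : 0 < start v.
  rewrite mem_p in vp; apply: (@last_before_ge _ _ 1); [apply: lucky1|]; lia.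
rewrite (_ : count _ p = count (ltn^~ (start v)) p).
  rewrite (permP pperm) (_ : n = (start v).-1 + (n - (start v).-1)).
    rewrite iotaD count_cat.
    rewrite (@eq_in_count _ _ predT) => [|z]; last by rewrite mem_iota /=; lia.
    rewrite [X in _ + X](@eq_in_count _ _ pred0) => [|z]; last by rewrite mem_iota /=; lia.
    by rewrite count_predT count_pred0 size_iota; lia.
  by move: vp; rewrite mem_p -/start in sv *; lia.
apply: eq_count => w /=; apply/idP/idP => h.
- by rewrite ltnNge; apply/negP => /(last_before_ge Ls); rewrite -/start; lia.
- exact: leq_ltn_trans (last_before_le _ _) h.
Qed.

(** A lucky car parks at its start, where the predecessor truncates; an unlucky one parks strictly
    past it, so the predecessor yields the spot just before its own, its preference. *)
Lemma unit_parks_spread_surj : spread (map start p) = a.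
Proof.
apply: (@eq_from_nth _ 0); first by rewrite size_spread size_map szp sza.
move=> i; rewrite size_spread size_map szp => ilt.
rewrite nth_mkseq ?size_map ?szp // (nth_map 0) ?szp // count_block //.
have si := last_before_le lucky (nth 0 p i); rewrite -/start in si.
have [_ /(_ i)] := parks; rewrite sza => /(_ ilt)[_ _ _].
case: (eqVneq (nth 0 a i) (nth 0 p i)) => [e _|ne].
  have Li : lucky (nth 0 p i) by rewrite lucky_nth // e.
  by have := last_before_ge Li (leqnn _); rewrite -/start; lia.
case=> [e|[e _]]; first by rewrite e eqxx in ne.
have := lucky_start (mem_nth 0 (_ : i < size p)); rewrite szp => /(_ ilt).
have [->|] := eqVneq (start (nth 0 p i)) (nth 0 p i); last by lia.
by rewrite lucky_nth // (negbTE ne).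
Qed.

End LuckySpots.

Lemma unit_interval_spread n (a : n.-tuple nat) :
  unit_interval_parking_function a ->
  exists2 b : n.-tuple nat, ranked b & spread_tuple b = a.
Proof.
case/unit_intervalP=> p parks.
have rb := unit_parks_ranked (size_tuple a) parks.
have eb := unit_parks_spread_surj (size_tuple a) parks.
set b := map _ p in rb eb.
have szb : size b == n by rewrite -size_spread eb size_tuple.
by exists (Tuple szb) => //; apply: val_inj.
Qed.

Theorem theorem4p6 (n : nat) (hn : 0 < n)
    (S : set nat) (hS : S `<=` [set k : nat | 0 < k]) :
  exists f : n.-tuple nat -> n.-tuple nat,
    set_bij (FR_T2 n S) (UPF_T2 n S) f.
Proof.
exists (@spread_tuple n); split.
- move=> b [/fubini_ranked rb hb]; split; last exact/block_sizes_spread.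
  apply/unit_intervalP; exists (spots b).
  by have := unit_parks_spread rb; rewrite size_tuple.
- move=> b c /set_mem[/fubini_ranked rb _] /set_mem[/fubini_ranked rc _].
  exact: spread_tuple_inj.
- move=> a [/unit_interval_spread[b rb <-] ha]; exists b => //.
  by split; [exact: ranked_fubini | exact/block_sizes_spread].
Qed.
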